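(* For any directed graph $G=(V,E)$ with $n=|V|$ nodes and all out-degrees at least $1$, any $\alpha\in(0,1)$, any source $s\in V$ and any $\varepsilon>0$, with probability at least $1-1/n$ the output of Algorithm A (described in the context) satisfies $|\hat\pi(s,t)-\pi(s,t)|\le\varepsilon$ for all $t\in V$.
   Context: $d_{\mathrm{in}}(v),d_{\mathrm{out}}(v)$ are in/out-degrees and $\mathcal N_{\mathrm{in}}(v)$ the in-neighbor set. An $\alpha$-discounted random walk from $s$ terminates at its current node with probability $\alpha$ before each step and otherwise moves to a uniformly random out-neighbor; $\pi(s,t)$ (Personalized PageRank) is the probability that it terminates at $t$. Monte Carlo estimates with $k$ walks: simulate $k$ independent such walks from $s$ and estimate $\pi(s,v)$ by the fraction terminating at $v$. BackwardPush$(t,r_{\max})$: set $q(v,t)=0$ for all $v$, $r(t,t)=1$, $r(v,t)=0$ for $v\ne t$; while some $v$ has $r(v,t)>r_{\max}$, pick any such $v$, add $(1-\alpha)r(v,t)/d_{\mathrm{out}}(u)$ to $r(u,t)$ for each $u\in\mathcal N_{\mathrm{in}}(v)$, then add $\alpha r(v,t)$ to $q(v,t)$ and set $r(v,t)=0$; return all $q(v,t),r(v,t)$. Algorithm A (input $G,\alpha,s,\varepsilon$). Phase I: compute Monte Carlo estimates $\pi'(s,v)$ with $\lceil 12\ln(2n^3)/\varepsilon\rceil$ walks; $C=\{t:\pi'(s,t)>\varepsilon/2\}$. Phase II: $n_r=\lceil n/\varepsilon\rceil$, $n_t=\lceil 18\ln(2n^2)\rceil$, $r_{\max}(t)=\varepsilon^2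 n_r/(6\pi'(s,t))$ for $t\in C$. Repeat: for each $t\in C$ run BackwardPush$(t,\frac12 r_{\max}(t))$, but as soon as the total cost of Backward Push in the current repetition exceeds the expected cost of simulating $n_t\cdot\frac12 n_r$ random walks, abort and leave the repetition loop; if all $t\in C$ complete, set $n_r=\lfloor n_r/2\rfloor$, $r_{\max}(t)=\frac12 r_{\max}(t)$ for all $t\in C$, and repeat. After leaving the loop, run BackwardPush$(t,r_{\max}(t))$ with the current values for each $t\in C$, obtaining $q(v,t),r(v,t)$. Phase III: for $i=1,\dots,n_t$, independently compute Monte Carlo estimates $\pi''_i(s,v)$ with $n_r$ walks and set $\hat\pi_i(s,t)=q(s,t)+\sum_{v\in V}\pi''_i(s,v)r(v,t)$ for $t\in C$. Output $\hat\pi(s,t)=$ the $\lceil n_t/2\rceil$-th smallest of $\hat\pi_1(s,t),\dots,\hat\pi_{n_t}(s,t)$ for $t\in C$, and $\hat\pi(s,t)=0$ for $t\notin C$.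
   Formalization: If C is empty the repetition loop, which would never end, is left at once; in a push at a node with a self-loop the share sent to itself is kept rather than erased; each push has positive cost; a Monte Carlo estimate with n_r = 0 walks is 0. *)

(* Defs.v *)
From HB Require Import structures.
From mathcomp Require Import all_boot all_order all_algebra.
From mathcomp Require Import all_classical all_reals all_analysis.

Set Implicit Arguments.
Unset Strict Implicit.
Unset Printing Implicit Defensive.

Import Order.TTheory GRing.Theory Num.Theory.
Import numFieldNormedType.Exports.

Local Open Scope classical_set_scope.
Local Open Scope ring_scope.

(* A directed graph is a relation [e] on a finite type [V] (loops allowed);
   [e u v] is the edge from [u] to [v]. *)
Definition outdeg (V : finType) (e : rel V) (v : V) : nat := #|[set u | e v u]%SET|.

Definition nceil (R : realType) (x : R) : nat := `|Num.ceil x|%N.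

Section Walks.
Variables (R : realType) (V : finType) (e : rel V) (alpha : R).

(* A terminated walk from [v] is encoded by the sequence [w] of the nodes it
   visits after [v]; it terminates at [last v w]. *)
Fixpoint walk_prob (v : V) (w : seq V) : R :=
  if w is u :: w' then
    (1 - alpha) * ((e v u)%:R / (outdeg e v)%:R) * walk_prob u w'
  else alpha.

Definition ppr (s t : V) : R :=
  fine (\esum_(w in [set w : seq V | last s w = t]) (walk_prob s w)%:E).

Definition discounted_walk d (Omega : measurableType d)
    (P : probability Omega R) (s : V) (W : Omega -> seq V) : Prop :=
  (forall A : set (seq V), measurable (W @^-1` A)) /\
  (forall w : seq V, P [set omega | W omega = w] = (walk_prob s w)%:E).

Definition mc_estimate (s : V) (ws : seq (seq V)) (v : V) : R :=
  (count (fun w => last s w == v) ws)%:R / (size ws)%:R.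

(* Expectation of a non-negative cost of a walk. *)
Definition expected_walk_cost (s : V) (walk_cost : seq V -> R) : \bar R :=
  \esum_(w in [set: seq V]) (walk_prob s w * walk_cost w)%:E.

End Walks.

(* Mutual independence of a family of random variables with values in a set
   [T] (countable in our use) all of whose subsets are events. *)
Definition mutually_independent (R : realType) d (Omega : measurableType d)
    (P : probability Omega R) (I : choiceType) (T : Type)
    (X : I -> Omega -> T) : Prop :=
  forall (J : seq I) (A : I -> set T), uniq J ->
    P (\bigcap_(i in [set` J]) (X i @^-1` A i)) =
    (\prod_(i <- J) P (X i @^-1` A i))%E.

Section BackwardPush.
Variables (R : realType) (V : finType) (e : rel V) (alpha : R).

Record bp_state := BPState { reserve : V -> R ; residue : V -> R }.

Definition bp_init (t : V) : bp_state :=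
  BPState (fun _ => 0) (fun v => (v == t)%:R).

(* The residue of [v] being pushed is the one held at the beginning of the push.
   If [v] carries a loop then [v] is one of its own in-neighbours, and the
   share it sends to itself is not erased when [v] is reset. *)
Definition bp_push (st : bp_state) (v : V) : bp_state :=
  BPState
    (fun u => reserve st u + (if u == v then alpha * residue st v else 0))
    (fun u => (if u == v then 0 else residue st u) +
       (if e u v then (1 - alpha) * residue st v / (outdeg e u)%:R else 0)).

Definition bp_after (t : V) (vs : seq V) : bp_state :=
  foldl bp_push (bp_init t) vs.

Section Run.
Variables (pick : seq V -> V) (t : V) (theta : R).

(* [bp_partial vs]: BackwardPush(t, theta) pushes the nodes [vs], in this
   order, possibly before some more nodes; [pick] maps the nodes pushed so far
   to the next one. *)
Inductive bp_partial : seq V -> Prop :=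
| bp_partial_nil : bp_partial [::]
| bp_partial_rcons vs :
    bp_partial vs -> (exists v, theta < residue (bp_after t vs) v) ->
    bp_partial (rcons vs (pick vs)).

Definition bp_complete (vs : seq V) : Prop :=
  bp_partial vs /\ forall v, residue (bp_after t vs) v <= theta.

End Run.

(* A resolution of the choices that the algorithm leaves open: the order in
   which the targets in [C] are treated and the node to be pushed next. The
   choices may depend on the outcome [h] of the first sampling phase, on the
   number [k] of completed repetitions, on the target [t], on the nodes [vs]
   already pushed for it and on the threshold, but not on the walks that are
   simulated afterwards. *)
Record scheduler := Scheduler {
  sched_order : seq (seq V) -> nat -> {set V} -> seq V ;
  sched_pick : seq (seq V) -> nat -> V -> R -> seq V -> V ;
  sched_orderP : forall h k C, perm_eq (sched_order h k C) (enum C) ;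
  sched_pickP : forall h k t theta vs,
    (exists v, theta < residue (bp_after t vs) v) ->
    theta < residue (bp_after t vs) (sched_pick h k t theta vs) }.

End BackwardPush.

Section AlgorithmA.
Variables (R : realType) (V : finType) (e : rel V) (alpha : R).
Variables (s : V) (eps : R).
Variables (push_cost : V -> R) (walk_cost : seq V -> R).
Variable sched : scheduler e alpha.

Local Notation n := (#|V|%:R : R).

Definition n_phase1 : nat := nceil (12 * ln (2 * n ^+ 3) / eps).
Definition n_r0 : nat := nceil (n / eps).
Definition n_t : nat := nceil (18 * ln (2 * n ^+ 2)).

Definition candidates (h : seq (seq V)) : {set V} :=
  [set t | eps / 2 < mc_estimate R s h t]%SET.

Definition r_max0 (h : seq (seq V)) (t : V) : R :=
  eps ^+ 2 * n_r0%:R / (6 * mc_estimate R s h t).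

Definition pushes_cost (vs : seq V) : R := \sum_(v <- vs) push_cost v.

Definition budget (nr : nat) : \bar R :=
  ((n_t%:R * (nr%:R / 2))%:E * expected_walk_cost e alpha s walk_cost)%E.

Section Repetition.
Variables (h : seq (seq V)) (k : nat) (B : \bar R) (theta : V -> R).

(* [sweep ts c b]: with cost [c] already spent in the current repetition,
   treating the targets [ts] in turn ends with an abortion iff [b]. *)
Inductive sweep : seq V -> R -> bool -> Prop :=
| sweep_done c : sweep [::] c false
| sweep_next t ts c vs b :
    bp_complete e alpha (sched_pick sched h k t (theta t)) t (theta t) vs ->
    ((c + pushes_cost vs)%:E <= B)%E ->
    sweep ts (c + pushes_cost vs) b ->
    sweep (t :: ts) c b
| sweep_abort t ts c vs :
    bp_partial e alpha (sched_pick sched h k t (theta t)) t (theta t) vs ->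
    (B < (c + pushes_cost vs)%:E)%E ->
    sweep (t :: ts) c true.

End Repetition.

(* [phase2_loop h k nr rm k' nr' rm']: the repetition loop, entered after [k]
   completed repetitions with the values [nr] and [rm] of n_r and r_max, is left
   after [k'] completed repetitions with the values [nr'] and [rm'].
   If there is no candidate, Backward Push has no cost and is never aborted;
   there is then nothing to compute and the loop is left at once. *)
Inductive phase2_loop (h : seq (seq V)) :
    nat -> nat -> (V -> R) -> nat -> nat -> (V -> R) -> Prop :=
| loop_empty k nr rm :
    candidates h = finset.set0 -> phase2_loop h k nr rm k nr rm
| loop_abort k nr rm :
    sweep h k (budget nr) (fun t => rm t / 2)
      (sched_order sched h k (candidates h)) 0 true ->
    phase2_loop h k nr rm k nr rm
| loop_repeat k nr rm k' nr' rm' :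
    candidates h != finset.set0 ->
    sweep h k (budget nr) (fun t => rm t / 2)
      (sched_order sched h k (candidates h)) 0 false ->
    phase2_loop h k.+1 nr./2 (fun t => rm t / 2) k' nr' rm' ->
    phase2_loop h k nr rm k' nr' rm'.

(* [inl j] is the [j]-th walk of the first phase
   and [inr (i, j)] the [j]-th walk of the [i]-th trial of the third one. *)
Definition walk_index := (nat + nat * nat)%type.

Section Output.
Variable w : walk_index -> seq V.

Definition phase1_walks : seq (seq V) := mkseq (fun j => w (inl j)) n_phase1.

Definition trial_walks (nr i : nat) : seq (seq V) :=
  mkseq (fun j => w (inr (i, j))) nr.

(* When [nr = 0] the Monte Carlo estimate is 0 since 0 / 0 = 0. *)
Definition trial_estimate (nr : nat) (st : bp_state R V) (i : nat) : R :=
  reserve st s + \sum_(v : V) mc_estimate R s (trial_walks nr i) v * residue st v.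

Definition median_estimate (nr : nat) (st : bp_state R V) : R :=
  nth 0 (sort <=%R (mkseq (trial_estimate nr st) n_t)) (uphalf n_t).-1.

(* [algA_output out]: on the walks [w] the algorithm terminates and returns
   [out]. *)
Definition algA_output (out : V -> R) : Prop :=
  exists (k nr : nat) (rm : V -> R) (vs : V -> seq V),
    [/\ phase2_loop phase1_walks 0 n_r0 (r_max0 phase1_walks) k nr rm,
        forall t, t \in candidates phase1_walks ->
          bp_complete e alpha (sched_pick sched phase1_walks k t (rm t))
            t (rm t) (vs t)
      & forall t, out t = if t \in candidates phase1_walks
          then median_estimate nr (bp_after e alpha t (vs t)) else 0].

End Output.

End AlgorithmA.

(* Main.v *)
Require Import Defs.
From mathcomp Require Import all_boot all_order all_algebra.
From mathcomp Require Import all_classical all_reals all_analysis.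
From mathcomp Require Import ring lra zify.

Set Implicit Arguments.
Unset Strict Implicit.
Unset Printing Implicit Defensive.

Import Order.TTheory GRing.Theory Num.Theory.
Import numFieldNormedType.Exports.

Local Open Scope classical_set_scope.
Local Open Scope ring_scope.

(* Write [p t] for the Personalized PageRank of [t] and [p'] for its phase I
   estimate. Backward Push keeps the linear relation
   [q = (1 - alpha) P q + alpha (1_t - r)], which bounds the reserves by 1 (so the
   pushes terminate) and, paired with the last-step recursion of [p], yields
   [q s = p t - sum_v p v * r v]: a trial estimate is unbiased.

   A Chernoff bound for phase I shows that, up to probability [1 / (2 n)], no [t] has
   both [p t > 9/10 eps] and [p' t < 5/9 p t]. Hence [p t <= eps] off the candidate
   set and [p t <= 9/5 p' t] on it.

   After the loop, [n_r = m] and [r_max <= eps^2 (m + 1) / (6 p')], the [+ 1] coming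
   from the rounding. By Chebyshev a trial is wrong by more than [eps] with
   probability at most 1/3: for [m <= 9] bound the variance of a residue by
   [r_max^2 / 4], for [m >= 10] by [r_max * p t]; for [m = 0] the reserve alone is
   within [eps / 3]. The median of [n_t] trials then fails with probability at most
   [(8/9)^(n_t / 2) <= 1 / (2 n^2)].

   Everything past phase I is done for a fixed list [h] of phase I walks, of which the
   phase III walks are independent, and summed over the countably many [h]. *)

(** * Backward Push: invariant, termination and the error of the reserve *)

Section Push.
Variables (R : realType) (V : finType) (e : rel V).
Hypothesis outdeg_ge1 : forall v : V, (1 <= outdeg e v)%N.
Variable alpha : R.
Hypotheses (alpha_gt0 : 0 < alpha) (alpha_lt1 : alpha < 1).

Definition step_prob (u v : V) : R := (e u v)%:R / (outdeg e u)%:R.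

Lemma step_prob_ge0 u v : 0 <= step_prob u v.
Proof. by rewrite /step_prob divr_ge0 ?ler0n. Qed.

Lemma sum_step_prob u : \sum_v step_prob u v = 1.
Proof.
rewrite /step_prob -big_distrl /= -natr_sum.
rewrite (_ : (\sum_v e u v)%N = outdeg e u).
  by rewrite divff// pnatr_eq0 -lt0n.
by rewrite /outdeg -sum1_card [RHS]big_mkcond; apply: eq_bigr => v _; rewrite inE; case: (e u v).
Qed.

(** The equation is a one-step form of the usual [pi(u,t) = q(u) + sum_v pi(u,v) r(v)]. It avoids
    Personalized PageRank from any node other than [s]. *)
Definition bp_invariant (t : V) (st : bp_state R V) : Prop :=
  [/\ forall u, 0 <= reserve st u, forall u, 0 <= residue st u &
      forall u, reserve st u = (1 - alpha) * (\sum_v step_prob u v * reserve st v) +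
        alpha * ((u == t)%:R - residue st u)].

(** On the right-hand side, the mass [(1 - alpha) * alpha * r v] carried by the new reserve of [v]
    cancels against the residue sent to the in-neighbours. What remains is [alpha * r v] at [v], as
    on the left. *)
Lemma bp_invariant_push t st v :
  bp_invariant t st -> bp_invariant t (bp_push e alpha st v).
Proof.
move=> [q0 r0 eqn]; split => /=.
- move=> u; case: ifP => _; last by rewrite addr0.
  by rewrite addr_ge0 // mulr_ge0 // ltW.
- move=> u; rewrite addr_ge0 //; first by case: ifP.
  case: ifP => // _; rewrite divr_ge0 ?mulr_ge0 ?subr_ge0 //; exact: ltW.
- move=> u.
  rewrite (eq_bigr (fun w => step_prob u w * reserve st w +
      (if w == v then step_prob u v * (alpha * residue st v) else 0))); last first.
    by move=> w _; rewrite mulrDr; case: eqP => [->//|_]; rewrite mulr0.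
  rewrite big_split /= -big_mkcond big_pred1_eq.
  rewrite [in LHS]eqn.
  have -> : (if e u v then (1 - alpha) * residue st v / (outdeg e u)%:R else 0) =
    (1 - alpha) * residue st v * step_prob u v.
    by rewrite /step_prob; case: ifP => _; rewrite ?mul0r ?mulr0 // mul1r.
  have -> : (if u == v then 0 else residue st u) =
    residue st u - (if u == v then residue st v else 0).
    by case: eqP => [->|_]; rewrite ?subrr ?subr0.
  have -> : (if u == v then alpha * residue st v else 0) =
    alpha * (if u == v then residue st v else 0) by case: eqP; rewrite ?mulr0.
  by ring.
Qed.

Lemma bp_invariant_after t vs : bp_invariant t (bp_after e alpha t vs).
Proof.
rewrite /bp_after; have : bp_invariant t (@bp_init R V t).
  split => //= u; rewrite subrr mulr0 addr0 big1 ?mulr0 // => v _; exact: mulr0.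
elim: vs (bp_init _ t) => //= v vs IH st Ht; apply: IH; exact: bp_invariant_push.
Qed.

(** Maximum principle: where [q] is maximal, its average over out-neighbours is at most [q], so the
    invariant gives [q <= (1 - alpha) * q + alpha]. *)
Lemma bp_reserve_le1 t st : bp_invariant t st -> forall u, reserve st u <= 1.
Proof.
move=> [q0 r0 eqn] u0.
have [u _ umax] := @arg_maxP _ _ _ u0 predT (reserve st) isT.
apply: (le_trans (umax u0 isT)).
have H : \sum_v step_prob u v * reserve st v <= reserve st u.
  rewrite -[leRHS]mul1r -(sum_step_prob u) big_distrl /=.
  apply: ler_sum => v _; apply: ler_wpM2l; first exact: step_prob_ge0.
  exact: umax.
have := eqn u; have := r0 u.
have : ((u == t)%:R : R) <= 1 by case: eqP.
move: alpha_gt0 alpha_lt1 H.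
set S := \sum_v _; set q := reserve _ _; set r := residue _ _; set b := _%:R => *; nra.
Qed.

(* Each push moves more than [alpha * theta] into a reserve, and no reserve exceeds 1. *)
Lemma bp_complete_exists (pick : seq V -> V) (t : V) (theta : R) :
  0 < theta ->
  (forall vs, (exists v, theta < residue (bp_after e alpha t vs) v) ->
     theta < residue (bp_after e alpha t vs) (pick vs)) ->
  exists vs, bp_complete e alpha pick t theta vs.
Proof.
move=> theta0 pickP; apply: contrapT => nocomplete.
have long (m : nat) : exists vs, bp_partial e alpha pick t theta vs /\
    m%:R * (alpha * theta) <= \sum_u reserve (bp_after e alpha t vs) u.
  elim: m => [|m [vs [pvs hvs]]].
    exists [::]; split; first exact: bp_partial_nil.
    by rewrite mul0r sumr_ge0.
  have /existsNP[v hv] : ~ (forall v, residue (bp_after e alpha t vs) v <= theta).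
    by move=> H; apply: nocomplete; exists vs.
  have ex : exists v, theta < residue (bp_after e alpha t vs) v.
    by exists v; rewrite ltNge; apply/negP.
  exists (rcons vs (pick vs)); split; first exact: bp_partial_rcons.
  rewrite /bp_after foldl_rcons -/(bp_after e alpha t vs) /= big_split /=.
  rewrite -big_mkcond big_pred1_eq -natr1 mulrDl mul1r lerD // ler_wpM2l //; first exact: ltW.
  by apply: ltW; apply: pickP.
have at0 : 0 < alpha * theta by rewrite mulr_gt0.
have [m hm] : exists m : nat, #|V|%:R / (alpha * theta) < m%:R.
  by exists (Num.truncn (#|V|%:R / (alpha * theta))).+1; rewrite truncnS_gt.
have [vs [_ hvs]] := long m.
have : \sum_u reserve (bp_after e alpha t vs) u <= #|V|%:R.
  rewrite -sum1_card natr_sum; apply: ler_sum => u _.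
  exact: (bp_reserve_le1 (bp_invariant_after t vs)).
move=> /(le_trans hvs); rewrite leNgt => /negP; apply.
by rewrite -ltr_pdivrMr.
Qed.

(* Pairing the local invariant with a solution [p] of the last-step recursion. *)
Lemma bp_reserve_eq (p : V -> R) (s t : V) (st : bp_state R V) :
  (forall v, p v = alpha * (s == v)%:R +
     (1 - alpha) * \sum_u p u * step_prob u v) ->
  bp_invariant t st ->
  reserve st s = p t - \sum_v p v * residue st v.
Proof.
move=> prec [q0 r0 eqn].
(* [E1] expands the pairing by the invariant of the reserves, [E2] by the recursion of [p]. The
   double sums agree and [alpha] cancels. *)
have E1 : \sum_u p u * reserve st u =
    (1 - alpha) * \sum_u \sum_v p u * step_prob u v * reserve st v +
    alpha * (p t - \sum_u p u * residue st u).
  rewrite (eq_bigr (fun u => (1 - alpha) * (\sum_v p u * step_prob u v * reserve st v) +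
     alpha * (p u * (u == t)%:R - p u * residue st u))); last first.
    move=> u _; rewrite {1}eqn.
    under [in RHS]eq_bigr do rewrite -mulrA.
    rewrite -big_distrr /=; ring.
  rewrite big_split /= -!big_distrr /= sumrB; congr (_ + _ * (_ - _)).
  rewrite (bigD1 t) //= eqxx mulr1 big1 ?addr0 // => u /negbTE ->; exact: mulr0.
have E2 : \sum_u p u * reserve st u = alpha * reserve st s +
    (1 - alpha) * \sum_u \sum_v p u * step_prob u v * reserve st v.
  rewrite (eq_bigr (fun u => alpha * ((s == u)%:R * reserve st u) +
     (1 - alpha) * (\sum_v p v * step_prob v u * reserve st u))); last first.
    by move=> u _; rewrite {1}prec -big_distrl /=; ring.
  rewrite big_split /= -!big_distrr /=; congr (_ * _ + _ * _).
    rewrite (bigD1 s) //= eqxx mul1r big1 ?addr0 // => u.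
    by rewrite eq_sym => /negbTE ->; rewrite mul0r.
  exact: exchange_big.
apply: (mulfI (lt0r_neq0 alpha_gt0)).
by move: E1; rewrite E2 addrC => /addrI.
Qed.

End Push.

(** * Termination of the repetition loop *)

Section Loop.
Variables (R : realType) (V : finType) (e : rel V).
Hypothesis outdeg_ge1 : forall v : V, (1 <= outdeg e v)%N.
Variable alpha : R.
Hypotheses (alpha_gt0 : 0 < alpha) (alpha_lt1 : alpha < 1).
Variables (s : V) (eps : R) (push_cost : V -> R) (walk_cost : seq V -> R).
Hypothesis push_cost_gt0 : forall v : V, 0 < push_cost v.
Variable sched : scheduler e alpha.

Lemma sched_complete_exists h k t theta : 0 < theta ->
  exists vs, bp_complete e alpha (sched_pick sched h k t theta) t theta vs.
Proof.
move=> theta0; apply: bp_complete_exists => // vs; exact: sched_pickP.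
Qed.

Lemma sweep_exists h k B theta ts c : (forall t, t \in ts -> 0 < theta t) ->
  exists b, sweep push_cost sched h k B theta ts c b.
Proof.
elim: ts c => [|t ts IH] c theta0; first by exists false; apply: sweep_done.
have [vs hvs] := sched_complete_exists h k t (theta0 t (mem_head _ _)).
have [le|gt] := leP (c + pushes_cost push_cost vs)%:E B; last first.
  by exists true; apply: (sweep_abort ts (proj1 hvs)).
have [|b hb] := IH (c + pushes_cost push_cost vs).
  by move=> u uts; apply: theta0; rewrite inE uts orbT.
by exists b; apply: (sweep_next hvs).
Qed.

(** The initial residue 1 of [t] exceeds the threshold, so a complete run makes at least one push,
    whose positive cost exceeds the budget. *)
Lemma sweep_abort_budget0 h k theta t ts : 0 < theta t -> theta t < 1 ->
  sweep push_cost sched h k 0%E theta (t :: ts) 0 true.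
Proof.
move=> theta0 theta1.
have [vs [pvs hvs]] := sched_complete_exists h k t theta0.
apply: (sweep_abort ts pvs); rewrite add0r lte_fin.
case: vs hvs {pvs} => [/(_ t) /=|v vs _].
  by rewrite eqxx leNgt theta1.
rewrite /pushes_cost big_cons ltr_pwDl // sumr_ge0 // => u _; exact: ltW.
Qed.

(** Induction on a number [m] of halvings that brings [n_r] to 0; a repetition with budget 0 then
    aborts. The exponent is [m.+1] because each repetition pushes with half of the current
    [r_max]. *)
Lemma phase2_loop_exists h m k nr (rm : V -> R) :
  (nr %/ 2 ^ m = 0)%N ->
  (forall t, t \in candidates s eps h -> 0 < rm t) ->
  (forall t, t \in candidates s eps h -> rm t / 2 ^+ m.+1 < 1) ->
  exists k' j rm', [/\
    phase2_loop s eps push_cost walk_cost sched h k nr rm k' (nr %/ 2 ^ j) rm' &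
    forall t, rm' t = rm t / 2 ^+ j].
Proof.
have [C0|C0] := eqVneq (candidates s eps h) finset.set0.
  move=> _ _ _; exists k, 0%N, rm; split; last by move=> t; rewrite expr0 divr1.
  by rewrite expn0 divn1; exact: loop_empty.
have ordC k0 t : (t \in sched_order sched h k0 (candidates s eps h)) = (t \in candidates s eps h).
  by rewrite (perm_mem (sched_orderP sched _ _ _)) mem_enum.
elim: m k nr rm => [|m IH] k nr rm.
  rewrite expn0 divn1 expr1 => -> rm0 rm1.
  exists k, 0%N, rm; split; last by move=> t; rewrite expr0 divr1.
  rewrite expn0 divn1; apply: loop_abort.
  (* For [n_r = 0] the budget is 0 even if the expected walk cost is infinite, as [0 * +oo = 0]. *)
  rewrite /budget mul0r mulr0 mul0e.
  have := ordC k; case: (sched_order _ _ _ _) => [|t ts] H.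
    by case/set0Pn: C0 => t; rewrite -H.
  have tC : t \in candidates s eps h by rewrite -H mem_head.
  by apply: sweep_abort_budget0; rewrite ?divr_gt0 ?rm1 ?rm0.
move=> nr0 rm0 rm1.
have [|b] := @sweep_exists h k (budget e alpha s walk_cost nr) (fun t => rm t / 2)
   (sched_order sched h k (candidates s eps h)) 0.
  by move=> t; rewrite ordC => tC; rewrite divr_gt0 ?rm0.
case: b => hb.
  exists k, 0%N, rm; split; last by move=> t; rewrite expr0 divr1.
  by rewrite expn0 divn1; apply: loop_abort.
have [| | |k' [j [rm' [hl hrm]]]] := IH k.+1 nr./2 (fun t => rm t / 2).
- by rewrite -divn2 -divnMA -expnS.
- by move=> t tC; rewrite divr_gt0 ?rm0.
- move=> t tC; rewrite -mulrA -invfM -exprS; exact: rm1.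
exists k', j.+1, rm'; split; last first.
  by move=> t; rewrite hrm -mulrA -invfM -exprS.
rewrite expnS divnMA divn2; exact: loop_repeat hb hl.
Qed.

End Loop.

(** * Tail bounds for independent samples from a finite distribution *)

Section FiniteProduct.
Variables (R : realType) (T : finType) (p : T -> R).
Hypotheses (p_ge0 : forall x, 0 <= p x) (p_sum1 : \sum_x p x = 1).

(** The law of an i.i.d. sample. It is used at two levels: for the end nodes of the walks of a
    trial, and, with whole trials as values, for the family of trials. *)
Definition prod_weight (I : finType) (f : {ffun I -> T}) : R := \prod_i p (f i).

Lemma prod_weight_ge0 (I : finType) (f : {ffun I -> T}) : 0 <= prod_weight f.
Proof. by apply: prodr_ge0 => i _. Qed.

Lemma sum_prod_weightM (I : finType) (F : I -> T -> R) :
  \sum_(f : {ffun I -> T}) prod_weight f * \prod_i F i (f i) =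
  \prod_i \sum_x p x * F i x.
Proof.
rewrite bigA_distr_bigA /=; apply: eq_bigr => f _; by rewrite -big_split.
Qed.

Lemma sum_prod_weight (I : finType) : \sum_(f : {ffun I -> T}) prod_weight f = 1.
Proof.
transitivity (\sum_(f : {ffun I -> T}) prod_weight f * \prod_(i : I) 1).
  by apply: eq_bigr => f _; rewrite big1 // mulr1.
rewrite (sum_prod_weightM (fun _ _ => 1)) big1 // => i _.
by under eq_bigr do rewrite mulr1.
Qed.

Lemma sum_markov (U : finType) (w : U -> R) (B : pred U) (g : U -> R) (c : R) :
  (forall x, 0 <= w x) -> (forall x, 0 <= g x) -> (forall x, B x -> c <= g x) ->
  c * \sum_(x | B x) w x <= \sum_x w x * g x.
Proof.
move=> w0 g0 Bg; rewrite [leRHS](bigID B) /= big_distrr /=.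
rewrite ler_wpDr ?sumr_ge0 // => [x _|]; first exact: mulr_ge0.
by apply: ler_sum => x Bx; rewrite mulrC ler_wpM2l ?Bg.
Qed.

Lemma sum_prod_weight_cross (I : finType) (x : T -> R) (a b : I) :
  \sum_v p v * x v = 0 ->
  \sum_(f : {ffun I -> T}) prod_weight f * (x (f a) * x (f b)) =
  if a == b then \sum_v p v * x v ^+ 2 else 0.
Proof.
move=> mean0.
(* Padding with factors 1 turns [x (f a) * x (f b)] into a product over all coordinates, whose
   expectation factors. *)
pose F i v := (if i == a then x v else 1) * (if i == b then x v else 1).
have prodE (f : {ffun I -> T}) : x (f a) * x (f b) = \prod_i F i (f i).
  by rewrite /F big_split /= -!big_mkcond !big_pred1_eq.
under eq_bigr do rewrite prodE.
rewrite sum_prod_weightM; have [ab|ab] := eqVneq a b.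
  rewrite (bigD1 a) //= [X in _ * X]big1 ?mulr1.
    by apply: eq_bigr => v _; rewrite /F -ab eqxx expr2.
  move=> i ia; rewrite -[RHS]p_sum1; apply: eq_bigr => v _.
  by rewrite /F -ab (negbTE ia) !mulr1.
rewrite (bigD1 a) //= (_ : \sum_v _ = 0) ?mul0r // -[RHS]mean0.
by apply: eq_bigr => v _; rewrite /F eqxx (negbTE ab) mulr1.
Qed.

Lemma variance_sum (I : finType) (x : T -> R) : \sum_v p v * x v = 0 ->
  \sum_(f : {ffun I -> T}) prod_weight f * (\sum_i x (f i)) ^+ 2 =
  #|I|%:R * \sum_v p v * x v ^+ 2.
Proof.
move=> mean0.
transitivity (\sum_(i : I) \sum_(j : I) \sum_(f : {ffun I -> T})
    prod_weight f * (x (f i) * x (f j))).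
  under [RHS]eq_bigr do rewrite exchange_big /=.
  rewrite [RHS]exchange_big /=; apply: eq_bigr => f _.
  rewrite expr2 big_distrl /= big_distrr /=; apply: eq_bigr => i _.
  by rewrite big_distrr /= big_distrr.
rewrite -[X in X%:R * _]sum1_card natr_sum big_distrl /=; apply: eq_bigr => i _.
rewrite (eq_bigr _ (fun j _ => sum_prod_weight_cross i j mean0)) -big_mkcond /=.
by rewrite (big_pred1 i) ?mul1r // => j; rewrite eq_sym.
Qed.

Lemma chebyshev_mean (m : nat) (r : T -> R) (eps v : R) :
  let mu := \sum_x p x * r x in
  (0 < m)%N -> 0 < eps -> \sum_x p x * (r x - mu) ^+ 2 <= v ->
  \sum_(f : {ffun 'I_m -> T} | eps < `|(\sum_j r (f j)) / m%:R - mu|) prod_weight f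
    <= v / (m%:R * eps ^+ 2).
Proof.
move=> mu m0 eps0 hv.
have m0' : 0 < m%:R :> R by rewrite ltr0n.
have mean0 : \sum_x p x * (r x - mu) = 0.
  under eq_bigr do rewrite mulrBr.
  by rewrite sumrB -big_distrl /= p_sum1 mul1r subrr.
have := @sum_markov _ (@prod_weight 'I_m)
  (fun f : {ffun 'I_m -> T} => eps < `|(\sum_j r (f j)) / m%:R - mu|)
  (fun f => (\sum_j (r (f j) - mu)) ^+ 2) ((m%:R * eps) ^+ 2).
rewrite (variance_sum _ mean0) card_ord => H.
have {}H : (m%:R * eps) ^+ 2 *
  (\sum_(f : {ffun 'I_m -> T} | eps < `|(\sum_j r (f j)) / m%:R - mu|) prod_weight f)
   <= m%:R * \sum_x p x * (r x - mu) ^+ 2.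
  apply: H => [f|f|f]; [exact: prod_weight_ge0|exact: sqr_ge0|].
  have -> : \sum_j (r (f j) - mu) = m%:R * ((\sum_j r (f j)) / m%:R - mu).
    rewrite sumrB sumr_const card_ord mulrBr [in RHS]mulrC divfK ?gt_eqF //.
    by rewrite mulr_natl.
  move=> Bf; rewrite !exprMn ler_wpM2l ?sqr_ge0 // -[leRHS]real_normK ?num_real //.
  by rewrite lerXn2r ?nnegrE ?normr_ge0 // ltW.
rewrite ler_pdivlMr ?mulr_gt0 ?exprn_gt0 // mulrC.
rewrite -(ler_pM2l m0') mulrA mulrA -expr2 -exprMn (le_trans H) //.
by rewrite ler_wpM2l // ltW.
Qed.

(** The variance is at most the second moment, and [r ^ 2 <= M * r] pointwise. *)
Lemma variance_le_mean (r : T -> R) (M : R) :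
  let mu := \sum_x p x * r x in
  (forall x, 0 <= r x <= M) -> \sum_x p x * (r x - mu) ^+ 2 <= M * mu.
Proof.
move=> mu rM.
have -> : \sum_x p x * (r x - mu) ^+ 2 = \sum_x p x * r x ^+ 2 - mu ^+ 2.
  rewrite (eq_bigr (fun x => p x * r x ^+ 2 - 2 * mu * (p x * r x) + mu ^+ 2 * p x)).
    by rewrite big_split sumrB /= -!big_distrr /= p_sum1 -/mu; ring.
  by move=> x _; ring.
rewrite lerBlDr ler_wpDr ?sqr_ge0 // big_distrr /=; apply: ler_sum => x _.
rewrite [leRHS]mulrCA ler_wpM2l // expr2 ler_wpM2r //; by case/andP: (rM x).
Qed.

(** The second moment about any centre bounds the variance; about [M / 2] it is at most
    [(M / 2) ^ 2]. *)
Lemma variance_popoviciu (r : T -> R) (M : R) :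
  let mu := \sum_x p x * r x in
  (forall x, 0 <= r x <= M) -> \sum_x p x * (r x - mu) ^+ 2 <= M ^+ 2 / 4.
Proof.
move=> mu rM.
have -> : \sum_x p x * (r x - mu) ^+ 2 =
    \sum_x p x * (r x - M / 2) ^+ 2 - (mu - M / 2) ^+ 2.
  rewrite (eq_bigr (fun x => p x * (r x - M / 2) ^+ 2 +
     (M - 2 * mu) * (p x * r x) + (mu ^+ 2 - (M / 2) ^+ 2) * p x)).
    by rewrite !big_split /= -!big_distrr /= p_sum1 -/mu; field.
  by move=> x _; field.
rewrite lerBlDr ler_wpDr ?sqr_ge0 //.
rewrite -[leRHS]mul1r -[X in _ <= X * _]p_sum1 big_distrl /=; apply: ler_sum => x _.
rewrite ler_wpM2l //; have /andP[r0 rlM] := rM x.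
rewrite -subr_ge0 (_ : _ - _ = r x * (M - r x)) ?mulr_ge0 ?subr_ge0 //; last by field.
Qed.

(* Chernoff's bound with the multiplier [exp (- 11/15)], slightly below [1/2]. *)
Lemma binomial_lower_tail (k : nat) (t : T) :
  \sum_(f : {ffun 'I_k -> T} |
      (\sum_j (f j == t)%:R : R) < 5 / 9 * (k%:R * p t)) prod_weight f
  <= expR (- (k%:R * p t * (5 / 54))).
Proof.
(* [exp (11/15) >= (1 + 11/120) ^ 8 >= 2], the last inequality by three successive squarings. *)
have a_half : expR (- (11 / 15)) <= 2^-1 :> R.
  rewrite expRN lef_pV2 ?posrE ?expR_gt0 //.
  rewrite (_ : 11 / 15 = 8%:R * (11 / 120)); last by field.
  rewrite expRM_natl.
  apply: (@le_trans _ _ ((1 + 11 / 120) ^+ 8)).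
    rewrite (exprM _ 2 4) (exprM _ 2 2); set x := (1 + _) ^+ 2.
    have hx : 119 / 100 <= x by rewrite /x; lra.
    have hx2 : 1416 / 1000 <= x ^+ 2 by nra.
    by nra.
  apply: lerXn2r; rewrite ?nnegrE ?expR_ge0 ?expR_ge1Dx //; lra.
set a := expR (- (11 / 15)) in a_half *.
have := @sum_markov _ (@prod_weight 'I_k)
  (fun f : {ffun 'I_k -> T} => (\sum_j (f j == t)%:R : R) < 5 / 9 * (k%:R * p t))
  (fun f => \prod_j (if f j == t then a else 1))
  (expR (- (11 / 15 * (5 / 9 * (k%:R * p t))))).
rewrite (sum_prod_weightM (fun _ x => if x == t then a else 1)) => H.
have {}H := H (fun f => prod_weight_ge0 f) _ _.
have meanE : \sum_x p x * (if x == t then a else 1) = 1 - p t * (1 - a).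
  rewrite -[X in _ = X - _]p_sum1 (bigD1 t) //= eqxx [in RHS](bigD1 t) //=.
  under eq_bigr => x /negbTE -> do rewrite mulr1.
  by ring.
(* Since [a <= 1/2], the mean [1 - p t * (1 - a)] is at most [1 - p t / 2]. *)
have mean_le : \sum_x p x * (if x == t then a else 1) <= expR (- (p t / 2)).
  apply: (le_trans _ (expR_ge1Dx _)); rewrite meanE.
  have := p_ge0 t; nra.
rewrite prodr_const card_ord in H.
(* The exponent arises as [11/15 * 5/9 - 1/2 = - 5/54]. *)
rewrite (_ : - _ = 11 / 15 * (5 / 9 * (k%:R * p t)) + k%:R * (- (p t / 2))); last by field.
rewrite expRD expRM_natl -ler_pdivrMl ?expR_gt0 // -expRN.
apply: (le_trans (H _ _)).
- by move=> f; apply: prodr_ge0 => j _; case: ifP => // _; exact: expR_ge0.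
- move=> f lt.
  rewrite (_ : \prod_j _ = expR (- (11 / 15 * \sum_j (f j == t)%:R))).
    by rewrite ler_expR lerN2 ler_wpM2l ?ltW.
  rewrite -mulNr big_distrr /= expR_sum; apply: eq_bigr => j _.
  by case: ifP => _; rewrite ?mulr1 // mulr0 expR0.
rewrite lerXn2r ?nnegrE ?expR_ge0 // sumr_ge0 // => x _.
by rewrite mulr_ge0 //; case: ifP => // _; exact: expR_ge0.
Qed.

(** Markov's inequality for 2 to the number of bad coordinates: its mean is at most [(4/3) ^ N], and
    it is at least [sqrt 2 ^ N] when half of them are bad. *)
Lemma majority_tail (N : nat) (bad : pred T) : \sum_(x | bad x) p x <= 1 / 3 ->
  \sum_(f : {ffun 'I_N -> T} | (N <= 2 * #|[set i | bad (f i)]%SET|)%N) prod_weight f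
  <= expR (- (N%:R / 18)).
Proof.
move=> hbad; set sq2 := Num.sqrt (2 : R).
have sq2_gt0 : 0 < sq2 by rewrite sqrtr_gt0.
have sq2E : sq2 ^+ 2 = 2 by rewrite sqr_sqrtr.
have sq2_ge1 : 1 <= sq2 by rewrite -[leLHS]sqrtr1 ler_wsqrtr // ler1n.
have := @sum_markov _ (@prod_weight 'I_N)
  (fun f : {ffun 'I_N -> T} => (N <= 2 * #|[set i | bad (f i)]%SET|)%N)
  (fun f => \prod_j (if bad (f j) then 2 else 1)) (sq2 ^+ N).
rewrite (sum_prod_weightM (fun _ x => if bad x then 2 else 1)) prodr_const card_ord => H.
have {}H := H (fun f => prod_weight_ge0 f) _ _.
have mean_le : \sum_x p x * (if bad x then 2 else 1) <= 4 / 3.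
  rewrite (eq_bigr (fun x => p x + (if bad x then p x else 0))); last first.
    by move=> x _; case: ifP => _; ring.
  rewrite big_split /= p_sum1 -big_mkcond; lra.
rewrite (_ : - _ = N%:R * (- 18^-1)); last by field.
rewrite expRM_natl -(ler_pM2l (exprn_gt0 N sq2_gt0)) -exprMn.
apply: (le_trans (H _ _)).
- by move=> f; apply: prodr_ge0 => j _; case: ifP.
- move=> f hN; rewrite -big_mkcond prodr_const.
  rewrite (eq_card (B := [set i | bad (f i)]%SET)); last by move=> i; rewrite !inE.
  by rewrite -sq2E -exprM ler_weXn2l.
apply: lerXn2r; rewrite ?nnegrE ?sumr_ge0 //.
- by move=> x _; rewrite mulr_ge0 //; case: ifP.
- by rewrite mulr_ge0 ?expR_ge0 ?ltW.
apply: (le_trans mean_le).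
(* After squaring, the claim is [16/9 <= 2 * exp (- 1/9)], which follows from
   [exp (- 1/9) >= 1 - 1/9]. *)
rewrite -(@ler_pXn2r _ 2) ?nnegrE ?mulr_ge0 ?expR_ge0 ?(ltW sq2_gt0) //.
rewrite [leRHS]exprMn sq2E -expRM_natl.
have := expR_ge1Dx (2%:R * (- 18^-1) : R); lra.
Qed.

End FiniteProduct.

(** * Countable sums, countable partitions and independence *)

Lemma esumZl (R : realType) (T : choiceType) (A : set T) (a : T -> \bar R) (c : R) :
  0 <= c -> (forall x, (0 <= a x)%E) ->
  (\esum_(x in A) (c%:E * a x) = c%:E * \esum_(x in A) a x)%E.
Proof.
move=> c0 a0; rewrite /esum -ereal_supZl //; last first.
  by apply/set0P; eexists; exists set0; first exact: fsets_set0.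
congr ereal_sup; apply/seteqP; split => [_ [F FA <-]|_ [_ [F FA <-] <-]] /=.
  exists (\sum_(x \in F) a x)%E; first by exists F.
  by rewrite ge0_mule_fsumr.
by exists F => //; rewrite ge0_mule_fsumr.
Qed.

Section CountablePartition.
Variables (d : measure_display) (Omega : measurableType d) (R : realType).
Variable P : {measure set Omega -> \bar R}.

Lemma measure_bigcup_esum (T : countType) (F : T -> set Omega) (A : set T) :
  (forall z, measurable (F z)) -> trivIset setT F ->
  P (\bigcup_(z in A) F z) = \esum_(z in A) P (F z).
Proof.
move=> mF tF.
(* Countable additivity is indexed by [nat], so [F] is transported along [pickle]. *)
pose G n := if pickle_inv n is Some z then F z else set0.
have GE z : G (pickle z) = F z by rewrite /G pickleK_inv.
have -> : \bigcup_(z in A) F z = \bigcup_(n in pickle @` A) G n.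
  by rewrite bigcup_image; apply: eq_bigcupr => z _; rewrite GE.
rewrite measure_bigcup.
- rewrite nneseries_esum // (_ : [set x | x \in pickle @` A] = pickle @` A).
    rewrite esum_image; first by apply: eq_esum => z _; rewrite GE.
    by move=> x y _ _; apply: (pcan_inj pickleK_inv).
  by apply/seteqP; split => x /=; rewrite in_setE.
- by move=> _ [z _ <-]; rewrite GE.
- move=> _ _ [z _ <-] [z' _ <-]; rewrite !GE => zz'; congr pickle.
  exact: tF.
Qed.

Lemma measure_bigcup_fin (T : finType) (F : T -> set Omega) (B : pred T) :
  (forall z, measurable (F z)) -> trivIset setT F ->
  P (\bigcup_(z in [set z | B z]) F z) = (\sum_(z | B z) P (F z))%E.
Proof.
move=> mF tF; rewrite measure_bigcup_esum // esum_fset //; last exact: finite_finset.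
rewrite (_ : [set z | B z] = [set` enum B]); last first.
  by apply/seteqP; split => z /=; rewrite mem_enum.
by rewrite -fsbig_seq ?enum_uniq // big_enum.
Qed.

End CountablePartition.

Section Fibers.
Variables (d : measure_display) (Omega : measurableType d).

(** For countable [T] this makes every preimage an event, with no sigma-algebra to be chosen on
    [T]. *)
Definition fiber_measurable (T : Type) (Z : Omega -> T) :=
  forall z, measurable [set omega | Z omega = z].

Lemma fiber_preimage (T : countType) (Z : Omega -> T) (A : set T) :
  fiber_measurable Z -> measurable (Z @^-1` A).
Proof.
move=> mZ.
rewrite (_ : Z @^-1` A = \bigcup_z (if z \in A then [set omega | Z omega = z] else set0)).
  apply: countable_bigcupT_measurable; first exact: countableP.
  by move=> z; case: ifP.
apply/seteqP; split => [omega AZ|omega [z _]] /=.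
  by exists (Z omega) => //; rewrite mem_set.
by case: ifPn => // /set_mem Az /= ->.
Qed.

Lemma measurable_forall (I : finType) (F : I -> set Omega) :
  (forall i, measurable (F i)) -> measurable [set omega | forall i, F i omega].
Proof.
move=> mF; rewrite (_ : [set _ | _] = \bigcap_(i in setT) F i).
  by apply: fin_bigcap_measurable => //; exact: finite_finset.
by apply/seteqP; split => omega /=; [move=> H i _|move=> H i]; apply: H.
Qed.

Lemma fiber_mkseq (T : eqType) (X : nat -> Omega -> T) n :
  (forall j, fiber_measurable (X j)) ->
  fiber_measurable (fun omega => mkseq (fun j => X j omega) n).
Proof.
move=> mX h; have [szh|szh] := eqVneq (size h) n; last first.
  rewrite (_ : [set _ | _] = set0) //; apply/seteqP; split => // omega /= E.
  by rewrite -E size_mkseq eqxx in szh.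
case: h szh => [|x0 h] szh.
  by rewrite -szh (_ : [set _ | _] = setT) //; apply/seteqP; split.
rewrite (_ : [set _ | _] =
  [set omega | forall j : 'I_n, [set omega | X j omega = nth x0 (x0 :: h) j] omega]).
  by apply: measurable_forall => j; exact: mX.
apply/seteqP; split => omega /=.
  by move=> <- j; rewrite nth_mkseq.
move=> H; apply: (@eq_from_nth _ x0); rewrite size_mkseq // => j jn.
by rewrite nth_mkseq // (H (Ordinal jn)).
Qed.

Lemma fiber_pair (T U : Type) (X : Omega -> T) (Y : Omega -> U) :
  fiber_measurable X -> fiber_measurable Y -> fiber_measurable (fun omega => (X omega, Y omega)).
Proof.
move=> mX mY [x y]; rewrite (_ : [set _ | _] = [set o | X o = x] `&` [set o | Y o = y]).
  exact: measurableI.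
by apply/seteqP; split => o /= [-> ->].
Qed.

End Fibers.

(** The indices in [J] and those hit by [c] are distinct, so both families of events form a single
    instance of mutual independence; [A'] gives the event attached to each index. *)
Lemma independent_split (R : realType) (d : measure_display) (Omega : measurableType d)
    (P : probability Omega R) (K : choiceType) (U : Type) (X : K -> Omega -> U)
    (J : seq K) (A : K -> set U) (I : finType) (c : I -> K) (B : I -> set U) :
  mutually_independent P X -> uniq J -> injective c -> (forall i, c i \notin J) ->
  P ((\bigcap_(x in [set` J]) (X x @^-1` A x)) `&`
     [set omega | forall i, B i (X (c i) omega)]) =
  (P (\bigcap_(x in [set` J]) (X x @^-1` A x)) * \prod_i P (X (c i) @^-1` B i))%E.
Proof.
move=> indep uJ injc cJ.
pose A' x := if x \in J then A x else [set u | forall i, c i = x -> B i u].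
have A'c i : A' (c i) = B i.
  rewrite /A' (negbTE (cJ i)); apply/seteqP; split => u /=; first exact.
  by move=> Bu j /injc ->.
have A'J x : x \in J -> A' x = A x by rewrite /A' => ->.
have uJc : uniq (J ++ map c (enum I)).
  rewrite cat_uniq uJ map_inj_uniq // enum_uniq andbT.
  by apply/hasPn => _ /mapP[i _ ->].
have -> : (\bigcap_(x in [set` J]) (X x @^-1` A x)) `&`
     [set omega | forall i, B i (X (c i) omega)] =
     \bigcap_(x in [set` J ++ map c (enum I)]) (X x @^-1` A' x).
  apply/seteqP; split => omega /=.
    move=> [HJ HB] x /=; rewrite mem_cat => /orP[xJ|/mapP[i _ ->]].
      by rewrite A'J //; exact: HJ.
    by rewrite A'c; exact: HB.
  move=> H; split => [x /= xJ|i].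
    by rewrite -(A'J x xJ); apply: (H x); rewrite /= mem_cat xJ.
  rewrite -A'c; apply: (H (c i)).
  by rewrite /= mem_cat map_f ?orbT // mem_enum.
rewrite indep // big_cat big_map big_enum /= indep //; congr (_ * _)%E.
  by rewrite big_seq [RHS]big_seq; apply: eq_bigr => x xJ; rewrite A'J.
by apply: eq_bigr => i _; rewrite A'c.
Qed.

(** * The law of the end node of a walk *)

Section WalkLaw.
Variables (R : realType) (V : finType) (e : rel V).
Hypothesis outdeg_ge1 : forall v : V, (1 <= outdeg e v)%N.
Variable alpha : R.
Hypotheses (alpha_gt0 : 0 < alpha) (alpha_lt1 : alpha < 1).
Variable s : V.
Variables (d : measure_display) (Omega : measurableType d) (P : probability Omega R).
Variable W : Omega -> seq V.
Hypothesis W_walk : discounted_walk e alpha P s W.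

Lemma walk_prob_ge0 v w : 0 <= walk_prob e alpha v w.
Proof.
elim: w v => [|u w IH] v /=; first exact: ltW.
by rewrite mulr_ge0 // mulr_ge0 ?divr_ge0 // subr_ge0 ltW.
Qed.

Lemma walk_prob_rcons v w u : walk_prob e alpha v (rcons w u) =
  walk_prob e alpha v w * ((1 - alpha) * step_prob R e (last v w) u).
Proof.
elim: w v => [|x w IH] v /=; first by rewrite /step_prob mulrC.
by rewrite IH !mulrA.
Qed.

Lemma walk_fiber : fiber_measurable W.
Proof. by move=> w; apply: (proj1 W_walk [set w]). Qed.

Lemma prob_last v : P [set omega | last s (W omega) = v] =
  \esum_(w in [set w | last s w = v]) (walk_prob e alpha s w)%:E.
Proof.
rewrite (eq_esum (b := fun w => P [set omega | W omega = w])); last first.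
  by move=> w _; rewrite (proj2 W_walk).
rewrite -measure_bigcup_esum.
- congr (P _); apply/seteqP; split => omega /=; first by exists (W omega).
  by move=> [w /= <- <-].
- exact: walk_fiber.
- by move=> w w' _ _ [omega [/= <- <-]].
Qed.

(** The sum defining [ppr] is a probability, hence finite, so [fine] loses nothing. *)
Lemma prob_last_ppr v :
  P [set omega | last s (W omega) = v] = (ppr e alpha s v)%:E.
Proof.
rewrite /ppr -prob_last fineK //; apply: fin_num_measure.
exact: (proj1 W_walk [set w | last s w = v]).
Qed.

Lemma ppr_ge0 v : 0 <= ppr e alpha s v.
Proof. by rewrite -lee_fin -prob_last_ppr. Qed.

(** [W] takes finite sequences as values, so every outcome has an end node; no geometric series is
    summed. *)
Lemma sum_ppr : \sum_v ppr e alpha s v = 1.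
Proof.
apply: EFin_inj; rewrite -sumEFin -(@probability_setT _ _ _ P).
rewrite (_ : setT = \bigcup_(v in [set v : V | predT v]) [set omega | last s (W omega) = v]).
  rewrite measure_bigcup_fin.
  - by apply: eq_bigr => v _; rewrite -prob_last_ppr.
  - by move=> v; apply: (proj1 W_walk [set w | last s w = v]).
  - by move=> v v' _ _ [omega [/= <- <-]].
by apply/seteqP; split => omega // _; exists (last s (W omega)).
Qed.

(** A walk ending at [v] is either empty, with [s = v], or of the form [rcons w v]; the latter are
    grouped by the end node [u] of [w]. *)
Lemma ppr_last_step v : ppr e alpha s v = alpha * (s == v)%:R +
  (1 - alpha) * \sum_u ppr e alpha s u * step_prob R e u v.
Proof.
apply: EFin_inj; rewrite -prob_last_ppr prob_last.
rewrite (esumID [set [::]]); last by move=> w _; rewrite lee_fin walk_prob_ge0.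
rewrite EFinD; congr (_ + _)%E.
  have [<-|sv] := eqVneq s v.
    rewrite (_ : _ `&` _ = [set [::]]); last by apply/seteqP; split => [w []//|w /= ->].
    by rewrite esum_set1 /= ?mulr1 // lee_fin ltW.
  rewrite (_ : _ `&` _ = set0) ?esum_set0 ?mulr0 //.
  apply/seteqP; split => // w /= [lw w0]; by rewrite w0 /= in lw; rewrite lw eqxx in sv.
rewrite (reindex_esum setT _ (fun w => rcons w v)); last first.
  split.
  - by move=> w _ /=; rewrite last_rcons; split => //; case: w.
  - by move=> w w' _ _ /rcons_inj[].
  - move=> w /= [lw w0]; case/lastP: w lw w0 => // w u; rewrite last_rcons => -> _.
    by exists w.
pose c u := (1 - alpha) * step_prob R e u v.
have c0 u : 0 <= c u by rewrite mulr_ge0 ?step_prob_ge0 // subr_ge0 ltW.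
(* Only the summand [u = last s w] is nonzero; this form lets the finite sum over [u] be pulled
   out. *)
rewrite (eq_esum (b := fun w => (\sum_u if w \in [set w | last s w = u]
     then (c u)%:E * (walk_prob e alpha s w)%:E else 0)%E)); last first.
  move=> w _; rewrite walk_prob_rcons (bigD1 (last s w)) //= mem_set // big1 => [|u ul].
    by rewrite adde0 -EFinM mulrC.
  by rewrite memNset //= => ul'; rewrite ul' eqxx in ul.
rewrite esum_sum; last first.
  by move=> w u _ _; case: ifP => // _; rewrite mule_ge0 // lee_fin // walk_prob_ge0.
rewrite big_distrr /= -sumEFin; apply: eq_bigr => u _.
rewrite -esum_mkcond esumZl //; last by move=> w; rewrite lee_fin walk_prob_ge0.
by rewrite -prob_last prob_last_ppr -EFinM /c; congr EFin; ring.
Qed.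

End WalkLaw.

(** * Medians and the failure probability of one trial *)

Lemma leq_double_ltn_median N c :
  (0 < N)%N -> (N - (uphalf N).-1 <= c)%N -> (N <= 2 * c)%N.
Proof. lia. Qed.

Lemma leq_double_geq_median N c : ((uphalf N).-1.+1 <= c)%N -> (N <= 2 * c)%N.
Proof. lia. Qed.

(** If the median is too large, so are all later entries of the sorted list; if too small, all
    earlier ones. Counting the median itself, either side holds at least half of the entries. *)
Lemma median_close (R : realDomainType) (xs : seq R) (c eps : R) :
  (2 * count (fun x => (eps < `|x - c|)%R) xs < size xs)%N ->
  `|nth 0 (sort <=%R xs) (uphalf (size xs)).-1 - c| <= eps.
Proof.
set a := fun x => _; rewrite -(count_sort <=%R) -(size_sort <=%R).
have : sorted <=%R (sort <=%R xs) by apply: sort_sorted; exact: le_total.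
move: (sort _ _) => ys sys hys.
have ys0 : (0 < size ys)%N by exact: leq_ltn_trans hys.
move mE : (uphalf _).-1 => m.
have szm : (m < size ys)%N by lia.
have nthle i j : (i <= j)%N -> (j < size ys)%N -> nth 0 ys i <= nth 0 ys j.
  move=> ij jn; apply: (sorted_leq_nth le_trans lexx) => //.
  exact: leq_ltn_trans jn.
rewrite leNgt; apply/negP => bad.
suff : (size ys <= 2 * count a ys)%N by rewrite leqNgt hys.
have [yc|cy] := leP c (nth 0 ys m).
  have : all a (drop m ys).
    apply/(all_nthP 0) => i; rewrite size_drop nth_drop => im.
    have im' : (m + i < size ys)%N by rewrite -ltn_subRL.
    have ymi := nthle _ _ (leq_addr i m) im'.
    rewrite /a ger0_norm ?subr_ge0 ?(le_trans yc) //; apply: (lt_le_trans bad).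
    by rewrite ger0_norm ?subr_ge0 // lerB.
  rewrite all_count size_drop => /eqP H.
  have : (count a (drop m ys) <= count a ys)%N.
    by rewrite -{2}(cat_take_drop m ys) count_cat leq_addl.
  by rewrite H -mE; exact: leq_double_ltn_median.
have : all a (take m.+1 ys).
  apply/(all_nthP 0) => i; rewrite size_takel // => im; rewrite nth_take //.
  have yim := nthle i m im szm.
  rewrite /a distrC gtr0_norm ?subr_gt0 ?(le_lt_trans yim) //; apply: (lt_le_trans bad).
  by rewrite distrC gtr0_norm ?subr_gt0 // lerB.
rewrite all_count size_takel // => /eqP H.
have : (count a (take m.+1 ys) <= count a ys)%N.
  by rewrite -{2}(cat_take_drop m.+1 ys) count_cat leq_addr.
by rewrite H -mE; exact: leq_double_geq_median.
Qed.

Lemma mc_estimate_sum (R : realType) (V : finType) (s : V) (ws : seq (seq V)) (r : V -> R) :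
  \sum_v mc_estimate R s ws v * r v =
  (\sum_(w <- ws) r (last s w)) / (size ws)%:R.
Proof.
rewrite /mc_estimate (eq_bigr (fun v => \sum_(w <- ws) (last s w == v)%:R * r v / (size ws)%:R)).
  rewrite exchange_big big_distrl /=; apply: eq_bigr => w _.
  rewrite (bigD1 (last s w)) //= eqxx mul1r big1 ?addr0 // => v.
  by rewrite eq_sym => /negbTE ->; rewrite !mul0r.
move=> v _; rewrite -!big_distrl /= -sum1_count natr_sum [in LHS]big_mkcond /= mulrAC.
by congr (_ * _ / _); apply: eq_bigr => w _; case: (_ == _).
Qed.

Lemma nceil_ge (R : realType) (x : R) : 0 <= x -> x <= (nceil x)%:R.
Proof.
move=> x0; rewrite /nceil natr_absz ger0_norm ?ceil_ge //.
by rewrite ceil_ge0 (lt_le_trans _ x0).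
Qed.

(* Rounding down when halving [n_r] costs a factor [(m + 1) / m] in the variance;
   for [m <= 9] the bound [M ^+ 2 / 4] absorbs it, and for [m >= 10] the constant [9 / 5] does. *)
Lemma trial_failure (R : realType) (V : finType) (p : V -> R) (r : V -> R)
    (m : nat) (q c M eps pi' : R) :
  (forall v, 0 <= p v) -> \sum_v p v = 1 ->
  (forall v, 0 <= r v <= M) -> 0 < eps -> eps / 2 < pi' ->
  M <= eps ^+ 2 * (m%:R + 1) / (6 * pi') ->
  0 <= q -> q = c - \sum_v p v * r v -> c <= 9 / 5 * pi' ->
  \sum_(f : {ffun 'I_m -> V} | eps < `|q + (\sum_j r (f j)) / m%:R - c|)
     prod_weight p f <= 1 / 3.
Proof.
move=> p0 p1 rM eps0 hpi hM q0 qE cpi.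
set mu := \sum_v p v * r v in qE *.
have pi0 : 0 < pi' by apply: lt_trans hpi; rewrite divr_gt0.
have muM : mu <= M.
  rewrite -[leRHS]mul1r -p1 big_distrl /=; apply: ler_sum => v _.
  by rewrite ler_wpM2l //; case/andP: (rM v).
have mu0 : 0 <= mu by apply: sumr_ge0 => v _; rewrite mulr_ge0 //; case/andP: (rM v).
have M0 : 0 <= M by exact: le_trans muM.
(* Here [pi' > eps / 2] enters. *)
have hM' : M <= eps * (m%:R + 1) / 3.
  apply: (le_trans hM); rewrite ler_pdivrMr ?mulr_gt0 //.
  have : 0 <= m%:R :> R by []. 
  have : 0 <= eps * (m%:R + 1) * (pi' - eps / 2).
    by rewrite !mulr_ge0 ?subr_ge0 ?addr_ge0 // ltW.
  nra.
have [m0|m0] := posnP m.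
  (* Without walks the average is [0 / 0 = 0], and the error is [mu <= M <= eps / 3]. *)
  subst m; rewrite big_pred0 ?divr_ge0 // => f; apply/negbTE; rewrite -leNgt.
  rewrite invr0 mulr0 addr0 qE addrAC subrr add0r normrN ger0_norm //.
  by apply: (le_trans muM); move: hM'; rewrite add0r mulr1; lra.
have m0' : 0 < m%:R :> R by rewrite ltr0n.
have shift (f : {ffun 'I_m -> V}) :
    q + (\sum_j r (f j)) / m%:R - c = (\sum_j r (f j)) / m%:R - mu by rewrite qE; ring.
under eq_bigl do rewrite shift.
have meps0 : 0 < m%:R * eps ^+ 2 by rewrite mulr_gt0 // exprn_gt0.
have [m9|m10] := leqP m 9.
  apply: (le_trans (chebyshev_mean p0 p1 m0 eps0 (variance_popoviciu p0 p1 rM))).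
  rewrite ler_pdivrMr //.
  have M2 : M ^+ 2 <= (eps * (m%:R + 1) / 3) ^+ 2.
    by rewrite lerXn2r // nnegrE // (le_trans M0).
  have m1 : 1 <= m%:R :> R by rewrite ler1n.
  have {}m9 : m%:R <= 9 :> R by rewrite ler_nat.
  (* The goal reduces to [(m + 1) ^ 2 <= 12 * m], which holds because [(m - 1) * (9 - m) >= 0]. *)
  have : 0 <= eps ^+ 2 * ((m%:R - 1) * (9 - m%:R)).
    by rewrite mulr_ge0 ?sqr_ge0 // mulr_ge0 ?subr_ge0.
  have := sqr_ge0 eps.
  nra.
apply: (le_trans (chebyshev_mean p0 p1 m0 eps0 (variance_le_mean p0 p1 rM))).
rewrite ler_pdivrMr // -/mu.
have {}m10 : 10 <= m%:R :> R by rewrite ler_nat.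
(* As [q >= 0], [mu <= c]. Then [M * mu <= 3/10 * eps ^ 2 * (m + 1)], and [9 * (m + 1) <= 10 * m]
   suffices. *)
have muc : mu <= 9 / 5 * pi' by apply: le_trans cpi; rewrite -subr_ge0 -qE.
have M1 : M * mu <= M * (9 / 5 * pi') by rewrite ler_wpM2l.
rewrite ler_pdivlMr ?mulr_gt0 // in hM.
have : 0 <= eps ^+ 2 * (m%:R - 10) by rewrite mulr_ge0 ?sqr_ge0 ?subr_ge0.
have := sqr_ge0 eps.
nra.
Qed.

Lemma sum_exists_le (R : numDomainType) (T U : finType) (B : T -> pred U) (w : U -> R) :
  (forall x, 0 <= w x) ->
  \sum_(x | [exists t, B t x]) w x <= \sum_t \sum_(x | B t x) w x.
Proof.
move=> w0; rewrite [leRHS](eq_bigr _ (fun t _ => big_mkcond (B t) w)).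
rewrite exchange_big /= big_mkcond /=; apply: ler_sum => x _.
case: ifPn => [/existsP[t Bt]|_]; last by apply: sumr_ge0 => t _; case: ifP.
rewrite (bigD1 t) //= Bt ler_wpDr //; by apply: sumr_ge0 => u _; case: ifP.
Qed.

(** * A complete second phase and its final thresholds *)

Section Run.
Variables (R : realType) (V : finType) (e : rel V).
Hypothesis outdeg_ge1 : forall v : V, (1 <= outdeg e v)%N.
Variable alpha : R.
Hypotheses (alpha_gt0 : 0 < alpha) (alpha_lt1 : alpha < 1).
Variables (s : V) (eps : R) (push_cost : V -> R) (walk_cost : seq V -> R).
Hypothesis eps_gt0 : 0 < eps.
Hypothesis push_cost_gt0 : forall v : V, 0 < push_cost v.
Variable sched : scheduler e alpha.

Lemma candidates_gt h t : t \in candidates s eps h -> eps / 2 < mc_estimate R s h t.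
Proof. by rewrite inE. Qed.

Lemma candidates_gt0 h t : t \in candidates s eps h -> 0 < mc_estimate R s h t.
Proof. by move=> /candidates_gt; apply: lt_trans; rewrite divr_gt0. Qed.

Lemma n_r0_gt0 : (0 < n_r0 V eps)%N.
Proof.
have n_eps : 0 < #|V|%:R / eps by rewrite divr_gt0 // ltr0n; apply/card_gt0P; exists s.
by rewrite -(ltr0n R); apply: (lt_le_trans n_eps (nceil_ge (ltW n_eps))).
Qed.

(** After [j] repetitions [r_max] has been divided by exactly [2 ^ j], while [n_r] was rounded down;
    [n_r0 / 2 ^ j < nr + 1] accounts for the [+ 1]. *)
Lemma phase2_exists h : exists k nr rm (vs : V -> seq V),
  [/\ phase2_loop s eps push_cost walk_cost sched h 0 (n_r0 V eps) (r_max0 s eps h) k nr rm,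
      forall t, t \in candidates s eps h ->
        bp_complete e alpha (sched_pick sched h k t (rm t)) t (rm t) (vs t)
    & forall t, t \in candidates s eps h ->
        rm t <= eps ^+ 2 * (nr%:R + 1) / (6 * mc_estimate R s h t)].
Proof.
have rm_gt0 t : t \in candidates s eps h -> 0 < r_max0 s eps h t.
  move=> /candidates_gt0 mc0; apply: divr_gt0; last exact: mulr_gt0.
  by rewrite mulr_gt0 ?exprn_gt0 // ltr0n n_r0_gt0.
(* Large enough that [2 ^ m] exceeds both [n_r0] and [eps * n_r0]; the latter bounds the initial
   [r_max] of a candidate. *)
pose m := (n_r0 V eps + (Num.truncn (eps * (n_r0 V eps)%:R)).+1)%N.
have [| | |k [j [rm [hl hrm]]]] :=
  @phase2_loop_exists _ _ _ outdeg_ge1 _ alpha_gt0 alpha_lt1 s eps _ walk_cost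
    push_cost_gt0 sched h m 0%N (n_r0 V eps) (r_max0 s eps h).
- rewrite divn_small //; apply: leq_ltn_trans (ltn_expl m (ltnSn 1)); exact: leq_addr.
- exact: rm_gt0.
- move=> t tC; rewrite ltr_pdivrMr ?exprn_gt0 // mul1r.
  have rm_le : r_max0 s eps h t <= eps * (n_r0 V eps)%:R.
    have mc_gt := candidates_gt tC; have mc0 := candidates_gt0 tC.
    rewrite /r_max0 ler_pdivrMr; last exact: mulr_gt0.
    have : 0 <= eps * (n_r0 V eps)%:R by rewrite mulr_ge0 // ltW.
    by move: (mc_estimate _ _ _ _) mc_gt mc0 => x; nra.
  apply: (le_lt_trans rm_le); apply: (lt_le_trans (truncnS_gt _)).
  rewrite -natrX ler_nat (leq_trans _ (ltnW (ltn_expl _ (ltnSn 1)))) //.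
  by apply: leqW; exact: leq_addl.
have [vs hvs] : exists vs : V -> seq V, forall t, t \in candidates s eps h ->
        bp_complete e alpha (sched_pick sched h k t (rm t)) t (rm t) (vs t).
  have H t : exists vs, t \in candidates s eps h ->
        bp_complete e alpha (sched_pick sched h k t (rm t)) t (rm t) vs.
    have [tC|tC] := boolP (t \in candidates s eps h); last by exists [::].
    have [|vs] := @sched_complete_exists _ _ _ outdeg_ge1 _ alpha_gt0 alpha_lt1 sched h k t (rm t).
      by rewrite hrm divr_gt0 ?exprn_gt0 // rm_gt0.
    by exists vs.
  exists (fun t => sval (cid (H t))) => t; exact: svalP (cid (H t)).
exists k, (n_r0 V eps %/ 2 ^ j)%N, rm, vs; split => // t tC.
rewrite hrm /r_max0 mulrAC ler_pM2r; last by rewrite invr_gt0 mulr_gt0 // candidates_gt0.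
rewrite -mulrA ler_wpM2l ?sqr_ge0 // ler_pdivrMr ?exprn_gt0 //.
by rewrite natr1 -natrX -natrM ler_nat ltnW // ltn_ceil // expn_gt0.
Qed.

End Run.

(** * Probability of an accurate run *)

Section Accuracy.
Variables (R : realType) (V : finType) (e : rel V).
Hypothesis outdeg_ge1 : forall v : V, (1 <= outdeg e v)%N.
Variable alpha : R.
Hypotheses (alpha_gt0 : 0 < alpha) (alpha_lt1 : alpha < 1).
Variables (s : V) (eps : R) (push_cost : V -> R) (walk_cost : seq V -> R).
Hypothesis eps_gt0 : 0 < eps.
Hypothesis push_cost_gt0 : forall v : V, 0 < push_cost v.
Variable sched : scheduler e alpha.
Variables (d : measure_display) (Omega : measurableType d) (P : probability Omega R).
Variable W : walk_index -> Omega -> seq V.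
Hypothesis W_walk : forall i : walk_index, discounted_walk e alpha P s (W i).
Hypothesis W_indep : mutually_independent P W.

Local Notation p := (ppr e alpha s).
Local Notation n := (#|V|%:R : R).

Definition accurate_run : set Omega :=
  [set omega | exists out : V -> R,
     algA_output s eps push_cost walk_cost sched (fun i => W i omega) out /\
     forall t : V, `|out t - p t| <= eps].

Let h_ omega := phase1_walks eps (fun i => W i omega).

Let n_gt0 : 0 < n.
Proof. by rewrite ltr0n; apply/card_gt0P; exists s. Qed.

Let n_ge1 : 1 <= n.
Proof. by rewrite ler1n; apply/card_gt0P; exists s. Qed.

Let p_ge0 v : 0 <= p v.
Proof. exact: (ppr_ge0 (W_walk (inl 0%N))). Qed.

Let p_sum1 : \sum_v p v = 1.
Proof. exact: (sum_ppr (W_walk (inl 0%N))). Qed.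

Lemma median_estimateE w nr (st : bp_state R V) :
  median_estimate s w nr st =
  nth 0 (sort <=%R [seq reserve st s + \sum_v mc_estimate R s ws v * residue st v
     | ws <- mkseq (trial_walks w nr) (n_t R V)]) (uphalf (n_t R V)).-1.
Proof. by rewrite /median_estimate /mkseq -map_comp. Qed.

Lemma phase1_fiber : fiber_measurable h_.
Proof.
apply: (@fiber_mkseq _ _ _ (fun j => W (inl j))) => j; exact: (walk_fiber (W_walk _)).
Qed.

(** For a fixed final [n_r], accuracy depends only on the phase I walks and finitely many phase III
    walks, a datum in a countable type; the event is a union over [n_r] of preimages. *)
Lemma measurable_accurate_run : measurable accurate_run.
Proof.
pose Z nr omega := (h_ omega, mkseq (trial_walks (fun i => W i omega) nr) (n_t R V)).
pose Q nr (z : seq (seq V) * seq (seq (seq V))) := exists k rm (vs : V -> seq V),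
  [/\ phase2_loop s eps push_cost walk_cost sched z.1 0 (n_r0 V eps) (r_max0 s eps z.1) k nr rm,
      forall t, t \in candidates s eps z.1 ->
        bp_complete e alpha (sched_pick sched z.1 k t (rm t)) t (rm t) (vs t)
    & forall t, `|(if t \in candidates s eps z.1 then
       let st := bp_after e alpha t (vs t) in
       nth 0 (sort <=%R [seq reserve st s + \sum_v mc_estimate R s ws v * residue st v
         | ws <- z.2]) (uphalf (n_t R V)).-1 else 0) - p t| <= eps].
rewrite (_ : accurate_run = \bigcup_nr (Z nr @^-1` [set z | Q nr z])).
  apply: bigcupT_measurable => nr; apply: fiber_preimage; apply: fiber_pair.
    exact: phase1_fiber.
  apply: (fiber_mkseq (X := fun i omega => trial_walks (fun i => W i omega) nr i)) => i.
  apply: (fiber_mkseq (X := fun j => W (inr (i, j)))) => j.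
  exact: (walk_fiber (W_walk _)).
apply/seteqP; split => omega /=.
  move=> [out [[k [nr [rm [vs [hl hc ho]]]]] hout]]; exists nr => //.
  exists k, rm, vs; split => // t; have := hout t; rewrite ho.
  by case: ifP => //; rewrite median_estimateE.
move=> [nr _ [k [rm [vs [hl hc ho]]]]].
exists (fun t => if t \in candidates s eps (h_ omega)
  then median_estimate s (fun i => W i omega) nr (bp_after e alpha t (vs t)) else 0).
split; first by exists k, nr, rm, vs; split.
by move=> t; have := ho t; rewrite /= median_estimateE.
Qed.

(** The constants match the cut at [eps / 2]: [9/10 * 5/9 = 1/2]. A candidate with [p t > 9/5 p']
    and a non-candidate with [p t > eps] are both witnesses. *)
Definition phase1_bad (h : seq (seq V)) : Prop :=
  exists t, 9 / 10 * eps < p t /\ mc_estimate R s h t < 5 / 9 * p t.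

Lemma phase1_bad_prob :
  (P [set omega | phase1_bad (h_ omega)] <= (1 / (2 * n))%:E)%E.
Proof.
pose k := n_phase1 V eps.
pose L := ln (2 * n ^+ 3).
have L0 : 0 < L.
  rewrite ln_gt0 //; have := exprn_ege1 3 n_ge1; lra.
have k_ge : 12 * L / eps <= k%:R.
  by apply: nceil_ge; rewrite divr_ge0 ?mulr_ge0 // ltW.
have k0 : 0 < (k%:R : R) by rewrite (lt_le_trans _ k_ge) // divr_gt0 // mulr_gt0.
pose bad (f : {ffun 'I_k -> V}) := [exists t, (9 / 10 * eps < p t) &&
   ((\sum_j (f j == t)%:R : R) < 5 / 9 * (k%:R * p t))].
pose F (f : {ffun 'I_k -> V}) :=
  [set omega | forall j : 'I_k, last s (W (inl (j : nat)) omega) = f j].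
have mF f : measurable (F f).
  apply: (@measurable_forall _ _ 'I_k
    (fun j => [set omega | last s (W (inl (j : nat)) omega) = f j])) => j.
  exact: (proj1 (W_walk _) [set w | last s w = f j]).
(* Badness depends only on the end nodes, so the event splits disjointly over the finitely many
   vectors [f] of end nodes. *)
have -> : [set omega | phase1_bad (h_ omega)] = \bigcup_(f in [set f | bad f]) F f.
  have mcE (omega : Omega) (f : {ffun 'I_k -> V}) t : F f omega ->
     mc_estimate R s (h_ omega) t = (\sum_j (f j == t)%:R) / k%:R.
    move=> Ff; rewrite /mc_estimate size_mkseq -/k -sum1_count natr_sum.
    rewrite big_mkcond big_map (_ : iota 0 _ = index_iota 0 k) ?big_mkord; last first.
      by rewrite /index_iota subn0.
    by congr (_ / _); apply: eq_bigr => j _; rewrite Ff; case: (_ == _).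
  apply/seteqP; split => omega /=.
    move=> [t [t1 t2]]; exists [ffun j : 'I_k => last s (W (inl (j : nat)) omega)].
      apply/existsP; exists t; rewrite t1 /= mulrCA -ltr_pdivrMl // mulrC.
      by rewrite -(mcE omega) // => j; rewrite ffunE.
    by move=> j; rewrite ffunE.
  move=> [f /existsP[t /andP[t1 t2]] Ff]; exists t; split => //.
  by rewrite (mcE _ _ _ Ff) ltr_pdivrMr // mulrAC -mulrA.
rewrite measure_bigcup_fin //; last first.
  by move=> f g _ _ [omega [Ff Fg]]; apply/ffunP => j; rewrite -Ff -Fg.
have PF f : P (F f) = (prod_weight p f)%:E.
  have := @independent_split _ _ _ P _ _ W [::] (fun _ => setT) 'I_k (fun j => inl (j : nat))
    (fun j => [set w | last s w = f j]) W_indep isT.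
  rewrite (_ : \bigcap_(_ in _) _ = setT); last first.
    by apply/seteqP; split => // omega _ x.
  rewrite setTI probability_setT mul1e => ->.
  - rewrite /prod_weight -prodEFin; apply: eq_bigr => j _.
    exact: (prob_last_ppr (W_walk _)).
  - by move=> i j [] /val_inj.
  - by [].
rewrite (eq_bigr _ (fun f _ => PF f)).
rewrite sumEFin lee_fin.
have n3_gt0 : 0 < 2 * n ^+ 3 by rewrite mulr_gt0 // exprn_gt0.
apply: (@le_trans _ _ (\sum_(t : V) (2 * n ^+ 3)^-1)).
  apply: (le_trans (sum_exists_le _ (fun f => prod_weight_ge0 p_ge0 f))).
  apply: ler_sum => t _; have [tp|tp] := ltP (9 / 10 * eps) (p t); last first.
    by rewrite big_pred0 // invr_ge0 ltW.
  apply: (le_trans (binomial_lower_tail p_ge0 p_sum1 k t)).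
  rewrite (_ : (2 * n ^+ 3)^-1 = expR (- L)) ?ler_expR ?lerN2; last by rewrite expRN lnK ?posrE.
  (* The constants fit exactly: [12 * 9/10 * 5/54 = 1], so each [t] contributes at most
     [exp (- L)]. *)
  have kp : 12 * L / eps * (9 / 10 * eps) <= k%:R * p t.
    apply: ler_pM => //; last exact: ltW.
      by rewrite divr_ge0 ?mulr_ge0 ?(ltW L0) ?(ltW eps_gt0).
    by rewrite mulr_ge0 ?(ltW eps_gt0).
  rewrite (_ : 12 * L / eps * (9 / 10 * eps) = 54 / 5 * L) in kp; last first.
    by field; rewrite gt_eqF.
  by move: kp; lra.
rewrite sumr_const -[leLHS]mulr_natl ler_pdivrMr // mulrC.
rewrite (_ : 2 * n ^+ 3 * (1 / (2 * n)) = n ^+ 2); last by field; rewrite gt_eqF.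
by rewrite expr2 ler_peMl // ltW.
Qed.

Lemma trial_estimateE w nr (st : bp_state R V) (i : nat) :
  trial_estimate s w nr st i =
  reserve st s + (\sum_(j < nr) residue st (last s (w (inr (i, j : nat))))) / nr%:R.
Proof.
rewrite /trial_estimate mc_estimate_sum size_mkseq big_map.
by rewrite (_ : iota 0 nr = index_iota 0 nr) ?big_mkord // /index_iota subn0.
Qed.

(** Whole phase I walks are fixed, not just their end nodes, since the scheduler may depend on all
    of [h]. *)
Lemma phase1_phase3_independent h N m (g : {ffun 'I_N -> {ffun 'I_m -> V}}) :
  P ([set omega | h_ omega = h] `&`
     [set omega | forall x : 'I_N * 'I_m,
        last s (W (inr (x.1 : nat, x.2 : nat)) omega) = g x.1 x.2]) =
  (P [set omega | h_ omega = h] * (prod_weight (@prod_weight _ _ p 'I_m) g)%:E)%E.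
Proof.
have [szh|szh] := eqVneq (size h) (n_phase1 V eps); last first.
  rewrite (_ : [set omega | h_ omega = h] = set0) ?set0I ?measure0 ?mul0e //.
  apply/seteqP; split => // omega /= E.
  by rewrite -E size_mkseq eqxx in szh.
pose A (x : walk_index) := if x is inl j then [set nth [::] h j] else setT.
have -> : [set omega | h_ omega = h] =
    \bigcap_(x in [set` [seq inl j : walk_index | j <- iota 0 (n_phase1 V eps)]]) (W x @^-1` A x).
  apply/seteqP; split => omega /=.
    move=> hE x /= /mapP[j]; rewrite mem_iota /= add0n => jk ->.
    by rewrite /A /= -hE nth_mkseq.
  move=> H; apply: (@eq_from_nth _ [::]); rewrite size_mkseq // => j jk.
  rewrite nth_mkseq //; apply: (H (inl j)).
  by rewrite /= map_f // mem_iota.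
rewrite (@independent_split _ _ _ P _ _ W _ A ('I_N * 'I_m)%type
  (fun x => inr (x.1 : nat, x.2 : nat)) (fun x => [set w | last s w = g x.1 x.2])) //.
- congr (_ * _)%E; rewrite /prod_weight pair_bigA /= -prodEFin.
  by apply: eq_bigr => x _; exact: (prob_last_ppr (W_walk _)).
- by rewrite map_inj_uniq ?iota_uniq // => i j [].
- by move=> [i j] [i' j'] /= [] /val_inj -> /val_inj ->.
- by move=> x; apply/mapP => -[].
Qed.

(** Once [h] is fixed, one run of phase II is chosen, so [m], [rm] and [vs] are constants and only
    the phase III walks remain random. *)
Lemma phase3_bad_prob h : ~ phase1_bad h ->
  (P ([set omega | h_ omega = h] `&` ~` accurate_run) <=
   (1 / (2 * n))%:E * P [set omega | h_ omega = h])%E.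
Proof.
move=> good.
have p_le t : t \in candidates s eps h -> p t <= 9 / 5 * mc_estimate R s h t.
  move=> /candidates_gt tC; rewrite leNgt; apply/negP => lt.
  by apply: good; exists t; split; move: lt tC; lra.
have p_small t : t \notin candidates s eps h -> p t <= eps.
  rewrite inE -leNgt => tC; rewrite leNgt; apply/negP => lt.
  by apply: good; exists t; split; move: lt tC eps_gt0; lra.
have [k [m [rm [vs [hl hc hrm]]]]] := @phase2_exists _ _ _ outdeg_ge1 _ alpha_gt0
  alpha_lt1 s eps _ walk_cost eps_gt0 push_cost_gt0 sched h.
pose N := n_t R V.
pose st t := bp_after e alpha t (vs t).
pose fail t (f : {ffun 'I_m -> V}) :=
  eps < `|reserve (st t) s + (\sum_j residue (st t) (f j)) / m%:R - p t|.
pose bad (g : {ffun 'I_N -> {ffun 'I_m -> V}}) :=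
  [exists t, (t \in candidates s eps h) && (N <= 2 * #|[set i | fail t (g i)]%SET|)%N].
pose G (g : {ffun 'I_N -> {ffun 'I_m -> V}}) :=
  [set omega | forall x : 'I_N * 'I_m,
     last s (W (inr (x.1 : nat, x.2 : nat)) omega) = g x.1 x.2].
have mG g : measurable (G g).
  apply: (@measurable_forall _ _ ('I_N * 'I_m)%type
    (fun x => [set omega | last s (W (inr (x.1 : nat, x.2 : nat)) omega) = g x.1 x.2])) => x.
  exact: (proj1 (W_walk _) [set w | last s w = g x.1 x.2]).
have mh : measurable [set omega | h_ omega = h] by exact: phase1_fiber.
have mhG g : measurable ([set omega | h_ omega = h] `&` G g) by exact: measurableI.
have sub : [set omega | h_ omega = h] `&` ~` accurate_run `<=`
    \bigcup_(g in [set g | bad g]) ([set omega | h_ omega = h] `&` G g).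
  move=> omega [/= hE Nacc].
  pose g := [ffun i : 'I_N => [ffun j : 'I_m =>
    last s (W (inr (i : nat, j : nat)) omega)]].
  have Gg : G g omega by move=> x; rewrite !ffunE.
  (* If for every candidate fewer than half of the trials fail, the medians form an accurate
     output. *)
  exists g => //=; apply: contrapT => /negP; rewrite negb_exists => /forallP ng; apply: Nacc.
  exists (fun t => if t \in candidates s eps h
    then median_estimate s (fun i => W i omega) m (st t) else 0).
  split.
    by exists k, m, rm, vs; rewrite -/(h_ omega) hE; split.
  move=> t; case: ifPn => tC; last first.
    by rewrite sub0r normrN ger0_norm // p_small.
  have := ng t; rewrite tC /= -ltnNge => few.
  rewrite /median_estimate -/N; set xs := mkseq _ _.
  rewrite -[X in uphalf X](size_mkseq (trial_estimate s (W^~ omega) m (st t)) N) -/xs.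
  apply: median_close; rewrite size_mkseq; apply: leq_ltn_trans few.
  rewrite leq_mul2l /= /xs /mkseq count_map -sum1_count -sum1_card.
  rewrite (_ : iota 0 N = index_iota 0 N) ?big_mkord; last by rewrite /index_iota subn0.
  apply: eq_leq; apply: eq_bigl => i.
  rewrite inE /= trial_estimateE /fail ffunE.
  by under [in RHS]eq_bigr do rewrite ffunE.
apply: (@le_trans _ _ (P (\bigcup_(g in [set g | bad g]) ([set omega | h_ omega = h] `&` G g)))).
  apply: le_measure; rewrite ?inE //.
  - apply: measurableI => //; exact: measurableC measurable_accurate_run.
  - by apply: fin_bigcup_measurable => //; exact: finite_finset.
rewrite measure_bigcup_fin //; last first.
  move=> g g' _ _ [omega [[_ Gg] [_ Gg']]]; apply/ffunP => i; apply/ffunP => j.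
  by rewrite -(Gg (i, j)) -(Gg' (i, j)).
rewrite (eq_bigr _ (fun g _ => etrans (phase1_phase3_independent h g) (muleC _ _))).
rewrite -ge0_sume_distrl; last first.
  by move=> g _; rewrite lee_fin; do 2![apply: prod_weight_ge0 => ?].
rewrite lee_wpmul2r // sumEFin lee_fin.
have w_ge0 (f : {ffun 'I_m -> V}) : 0 <= prod_weight p f by exact: prod_weight_ge0.
have w_sum1 : \sum_(f : {ffun 'I_m -> V}) prod_weight p f = 1 by exact: sum_prod_weight.
have n2_gt0 : 0 < 2 * n ^+ 2 by rewrite mulr_gt0 // exprn_gt0.
(* Union bound over the targets: [n / (2 * n ^ 2) = 1 / (2 * n)]. *)
apply: (@le_trans _ _ (\sum_(t : V) (2 * n ^+ 2)^-1)); last first.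
  rewrite sumr_const -[leLHS]mulr_natl (_ : n * _ = 1 / (2 * n)) //.
  by field; rewrite gt_eqF.
apply: (le_trans (sum_exists_le _ (fun f => prod_weight_ge0 w_ge0 f))).
apply: ler_sum => t _; have [tC|tC] /= := boolP (t \in candidates s eps h); last first.
  by rewrite big_pred0 // invr_ge0 ltW.
apply: (@le_trans _ _ (expR (- (N%:R / 18)))); last first.
  rewrite (_ : (2 * n ^+ 2)^-1 = expR (- ln (2 * n ^+ 2))) ?ler_expR ?lerN2; last first.
    by rewrite expRN lnK ?posrE.
  rewrite ler_pdivlMr // mulrC; apply: nceil_ge.
  rewrite mulr_ge0 // ln_ge0 //; have := exprn_ege1 2 n_ge1; lra.
apply: (majority_tail w_ge0 w_sum1).
have [q0 r0 _] := bp_invariant_after e alpha_gt0 alpha_lt1 t (vs t).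
apply: (@trial_failure _ _ p (residue (st t)) m _ _ (rm t) eps (mc_estimate R s h t)) => //.
- by move=> v; rewrite r0 (proj2 (hc t tC)).
- exact: candidates_gt.
- exact: hrm.
- apply: (bp_reserve_eq alpha_gt0 (ppr_last_step alpha_gt0 alpha_lt1 (W_walk (inl 0%N)))).
  exact: bp_invariant_after.
- exact: p_le.
Qed.

Lemma accurate_run_prob : ((1 - n^-1)%:E <= P accurate_run)%E.
Proof.
have mE := measurable_accurate_run.
have mN := measurableC mE.
have mh h : measurable [set omega | h_ omega = h] by exact: phase1_fiber.
suff H : (P (~` accurate_run) <= (n^-1)%:E)%E.
  move: H; rewrite probability_setC // -(fineK (fin_num_measure P _ mE)).
  by rewrite -EFinB !lee_fin lerBlDr addrC -lerBlDr.
have -> : ~` accurate_run =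
   \bigcup_(h in setT) ([set omega | h_ omega = h] `&` ~` accurate_run).
  by apply/seteqP; split => [omega Nw|omega [h _ []]//]; exists (h_ omega).
rewrite measure_bigcup_esum; last 2 first.
- by move=> h; apply: measurableI.
- by move=> h h' _ _ [omega [[/= <- _] [<- _]]].
have PhE (A : set (seq (seq V))) :
    P [set omega | A (h_ omega)] = \esum_(h in A) P [set omega | h_ omega = h].
  rewrite -measure_bigcup_esum //; last by move=> h h' _ _ [omega [/= <- <-]].
  congr (P _); apply/seteqP; split => [omega Aw|omega [h Ah /= ->]//].
  by exists (h_ omega).
(* A bad [h] is charged its whole probability, and every [h] a share [1 / (2 * n)] of it; the two
   sums are at most [1 / (2 * n)] each. *)
apply: (@le_trans _ _ (\esum_(h in setT)
  ((if h \in [set h | phase1_bad h] then P [set omega | h_ omega = h] else 0) +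
   (1 / (2 * n))%:E * P [set omega | h_ omega = h])%E)).
  apply: le_esum => h _; case: ifPn => [_|/negP hb].
    rewrite (@le_trans _ _ (P [set omega | h_ omega = h])) //.
      by apply: le_measure; rewrite ?inE //; exact: measurableI.
    by rewrite leeDl // mule_ge0 // lee_fin divr_ge0 // mulr_ge0.
  rewrite add0e; apply: phase3_bad_prob => hb'; apply: hb; exact: mem_set.
rewrite esumD; last 2 first.
- by move=> h _; case: ifP.
- by move=> h _; rewrite mule_ge0 // lee_fin divr_ge0 // mulr_ge0.
rewrite -esum_mkcond -PhE esumZl //.
rewrite -(PhE setT) (_ : [set _ | setT _] = setT) ?probability_setT ?mule1; last first.
  by apply/seteqP; split.
apply: (le_trans (leeD phase1_bad_prob (lexx _))).
by rewrite -EFinD lee_fin; rewrite (_ : _ + _ = n^-1) //; field; rewrite gt_eqF.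
Qed.

End Accuracy.

Theorem theorem8
  (R : realType) (V : finType) (e : rel V)
  (outdeg_ge1 : forall v : V, (1 <= outdeg e v)%N)
  (alpha : R) (alpha_gt0 : 0 < alpha) (alpha_lt1 : alpha < 1)
  (s : V) (eps : R) (eps_gt0 : 0 < eps)
  (push_cost : V -> R) (push_cost_gt0 : forall v : V, 0 < push_cost v)
  (walk_cost : seq V -> R) (walk_cost_ge0 : forall w : seq V, 0 <= walk_cost w)
  (sched : scheduler e alpha)
  (d : measure_display) (Omega : measurableType d) (P : probability Omega R)
  (W : walk_index -> Omega -> seq V)
  (W_walk : forall i : walk_index, discounted_walk e alpha P s (W i))
  (W_indep : mutually_independent P W) :
  ((1 - (#|V|%:R)^-1)%:E <=
   P [set omega | exists out : V -> R,
        algA_output s eps push_cost walk_cost sched (fun i => W i omega) out /\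
        forall t : V, (`|out t - ppr e alpha s t| <= eps)%R])%E.
Proof. exact: accurate_run_prob. Qed.
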